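(* Let $n\ge1$, $N=2^n$, and let $H=H^\dagger$ be a traceless Hermitian $N\times N$ matrix (interaction Hamiltonian) with $\|H\|_2=1$. The following are equivalent: (1) $H$ is locally sign-reversible of type I; (2) $-1\in W_{\rm loc}(H,H)$; (3) the local $C$-numerical range is the real line segment from $-1$ to $+1$: $W_{\rm loc}(-H,H)=[-1,+1]$; (4) there is $K\in\mathbf{SU}(2)^{\otimes n}$ with $\|KHK^{-1}+H\|_2^2=0$, i.e. $\operatorname{Ad}_K(H)=-H$; (5) $H$ is locally unitarily similar to some $\bar H$ with $\operatorname{Ad}_{K_z}(\bar H)=-\bar H$ for some local $z$-rotation $K_z$; (6) $H$ is locally unitarily similar to a linear combination of root-space elements of $\mathfrak{sl}(N,\mathbb C)$ to non-zero roots, $\bar H=\sum_{\lambda=1}^m c_\lambda E^{(\lambda)}_{ij}$ (each $E^{(\lambda)}_{ij}$ a matrix unit $E_{i_\lambda j_\lambda}$ with $i_\lambda\ne j_\lambda$, $c_\lambda\in\mathbb C$), for which there are angles $\phi_1,\dots,\phi_n\in\mathbb R$ satisfying the system $$\sum_{\ell=1}^n p_{\lambda,\ell}\,\phi_\ell=\pm\pi\ (\mathrm{mod}\ 2\pi),\qquad \lambda=1,\dots,m .$$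
   Context: $\mathbf{SU}(2)^{\otimes n}:=\{K_1\otimes\cdots\otimes K_n:K_\ell\in\mathbf{SU}(2)\}$; $\operatorname{Ad}_K(X):=KXK^{-1}$; $\|\cdot\|_2$ is the Frobenius norm. $H$ is locally sign-reversible of type I if some $K\in\mathbf{SU}(2)^{\otimes n}$ satisfies $Ke^{-itH}K^{-1}=e^{+itH}$ for all $t\in\mathbb R$. The local $C$-numerical range is $W_{\rm loc}(C,A):=\{\operatorname{tr}(C^\dagger KAK^{-1}) : K\in\mathbf{SU}(2)^{\otimes n}\}$. $H$ is locally unitarily similar to $\bar H$ if $\bar H=\bar K^{-1}H\bar K$ for some $\bar K\in\mathbf{SU}(2)^{\otimes n}$. A local $z$-rotation is $K_z=\bigotimes_{\ell=1}^n e^{-i\phi_\ell\sigma_z/2}$ with individual angles $\phi_\ell\in\mathbb R$. Root-space decomposition: $\mathfrak{sl}(N,\mathbb C)=\mathfrak g_0\oplus\bigoplus_{i\neq j}\mathbb C E_{ij}$ with $\mathfrak g_0$ the diagonal traceless matrices and $E_{ij}$ the matrix units. Each $E_{ij}$ is uniquely a tensor product of $n$ two-by-two matrix units from $J^\alpha=\begin{pmatrix}1&0\\0&0\end{pmatrix}$, $J^\beta=\begin{pmatrix}0&0\\0&1\end{pmatrix}$, $J_+=\begin{pmatrix}0&1\\0&0\end{pmatrix}$, $J_-=\begin{pmatrix}0&0\\1&0\end{pmatrix}$; $p_{\lambda,\ell}$ is $0,0,+1,-1$ according to whether the $\ell$-th factor of $E^{(\lambda)}_{ij}$ is $J^\alpha,J^\beta,J_+,J_-$.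 *)

(* Defs.v *)
From HB Require Import structures.
From mathcomp Require Import all_boot all_order all_algebra.
From mathcomp Require Import all_classical all_reals all_analysis.
From mathcomp Require Import complex mxtens.

Set Implicit Arguments.
Unset Strict Implicit.
Unset Printing Implicit Defensive.

Import Order.TTheory GRing.Theory Num.Theory.
Import numFieldNormedType.Exports.

Local Open Scope classical_set_scope.
Local Open Scope ring_scope.
Local Open Scope complex_scope.
Local Open Scope sesquilinear_scope.

Definition Ad (C : comUnitRingType) (n : nat) (K X : 'M[C]_n) : 'M[C]_n :=
  K *m X *m invmx K.

Definition frobenius (C : numClosedFieldType) (m n : nat) (A : 'M[C]_(m, n)) : C :=
  sqrtC (\sum_(i < m) \sum_(j < n) `|A i j| ^+ 2).

(* The limit is taken in the product (entrywise) topology of 'M[K]_n.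
   Stated over an abstract numFieldType because R[i] only receives its topology
   through that structure. *)
Definition expmx (K : numFieldType) (n : nat) (A : 'M[K]_n) : 'M[K]_n :=
  lim (series (fun k : nat => (k`!%:R)^-1 *: A ^+ k) @ \oo).

(* K_1 (x) ... (x) K_n, with the factor of index 0 leftmost; the cast is along
   2 * 2 ^ n = 2 ^ n.+1. *)
Fixpoint bigtens (C : pzRingType) (n : nat) : ('I_n -> 'M[C]_2) -> 'M[C]_(2 ^ n) :=
  match n with
  | 0 => fun=> 1%:M
  | n'.+1 => fun K =>
      castmx (esym (expnS 2 n'), esym (expnS 2 n'))
        (K ord0 *t bigtens (fun l : 'I_n' => K (lift ord0 l)))
  end.

Section LocalUnitaries.
Variable R : realType.
Local Notation C := R[i].

Definition SU2 : set 'M[C]_2 := [set U | U \is unitarymx /\ \det U = 1].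

Definition localSU2 (n : nat) : set 'M[C]_(2 ^ n) :=
  [set K | exists2 U : 'I_n -> 'M[C]_2, (forall l, SU2 (U l)) & K = bigtens U].

Definition sign_reversible_typeI (n : nat) (H : 'M[C]_(2 ^ n)) : Prop :=
  exists2 K, localSU2 K &
    forall t : R, Ad K (expmx ((- 'i * t%:C) *: H)) = expmx (('i * t%:C) *: H).

Definition Wloc (n : nat) (D A : 'M[C]_(2 ^ n)) : set C :=
  [set \tr (D ^t* *m Ad K A) | K in @localSU2 n].

Definition locally_similar (n : nat) (H Hbar : 'M[C]_(2 ^ n)) : Prop :=
  exists2 K, localSU2 K & Hbar = invmx K *m H *m K.

Definition sigma_z : 'M[C]_2 := delta_mx 0 0 - delta_mx 1 1.

Definition local_zrot (n : nat) (phi : 'I_n -> R) : 'M[C]_(2 ^ n) :=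
  bigtens (fun l => expmx ((- 'i * (phi l)%:C / 2) *: sigma_z)).

Definition eqmod2pi (x y : R) : Prop := exists k : int, x = y + k%:~R * (2 * pi).

End LocalUnitaries.

Variant munit := Jalpha | Jbeta | Jplus | Jminus.

Definition munit_mx (C : pzRingType) (J : munit) : 'M[C]_2 :=
  match J with
  | Jalpha => delta_mx 0 0
  | Jbeta => delta_mx 1 1
  | Jplus => delta_mx 0 1
  | Jminus => delta_mx 1 0
  end.

Definition munit_p (J : munit) : int :=
  match J with Jalpha => 0 | Jbeta => 0 | Jplus => 1 | Jminus => -1 end.

(* F lists the tensor factors of the matrix unit E_ij. Exactly one F does so for
   given i and j, so quantifying F existentially or universally is the same. *)
Definition tensor_factors (C : pzRingType) (n : nat) (i j : 'I_(2 ^ n))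
    (F : 'I_n -> munit) : Prop :=
  delta_mx i j = bigtens (fun l => munit_mx C (F l)).

(* Main.v *)
Require Import Defs.
From HB Require Import structures.
From mathcomp Require Import all_boot all_order all_algebra.
From mathcomp Require Import all_classical all_reals all_analysis.
From mathcomp Require Import complex mxtens.
From mathcomp Require Import ring lra.

Set Implicit Arguments.
Unset Strict Implicit.
Unset Printing Implicit Defensive.

Import Order.TTheory GRing.Theory Num.Theory.
Import numFieldNormedType.Exports.

Local Open Scope classical_set_scope.
Local Open Scope ring_scope.
Local Open Scope complex_scope.
Local Open Scope sesquilinear_scope.

(** Every K in SU(2)^{(x) n} is diagonalised by a local unitary: K = V Z V^* with Z a
    local z-rotation exp(i w_a) on the computational basis. With X = V^* H V,
    Hermitian symmetry of X gives
      tr(H^* Ad_K(H)) = sum_{a,b} |X_ab|^2 cos(w_a - w_b),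
    a convex combination of cosines when |H|_2 = 1. Scaling the angles by s in [0,1]
    moves this value continuously from 1 to its value at K, which is the segment in (3).
    Since |Ad_K(H) + H|^2 = 2 (1 + tr(H^* Ad_K(H))), the value -1 is attained exactly
    when Ad_K(H) = -H, that is, Ad_Z(X) = -X, that is, exp(i(w_a - w_b)) = -1 wherever
    X_ab <> 0; and w_a - w_b = - sum_l p_l phi_l when E_ab has the root p. *)

(** * Entrywise limits and exponentials of diagonalised matrices *)

Section MatrixLimits.
Variables (K : numFieldType) (m n : nat).
Implicit Types (u : nat -> 'M[K]_(m, n)) (A : 'M[K]_(m, n)).

Lemma cvg_mx_coord u A :
  (forall i j, (fun k => u k i j) @ \oo --> A i j) -> u @ \oo --> A.
Proof.
move=> uA; apply/cvg_ballP => e e0.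
have uA' : \forall k \near \oo, forall i j, ball (A i j) e (u k i j).
  apply: filter_forall => i; apply: filter_forall => j.
  by have /cvg_ballP/(_ _ e0) := uA i j.
by apply: filterS uA' => k uAk; split.
Qed.

(** Uniqueness of the limit is checked entry by entry, so Hausdorffness is used only in the base
    field. *)
Lemma lim_mx_coord u A :
  (forall i j, (fun k => u k i j) @ \oo --> A i j) -> lim (u @ \oo) = A.
Proof.
move=> uA; have ulim : u @ \oo --> lim (u @ \oo).
  by apply/cvg_ex; exists A; exact: cvg_mx_coord.
apply/matrixP => i j.
have h : (fun k => u k i j) @ \oo --> lim (u @ \oo) i j.
  apply: (@cvg_comp _ _ _ u (fun M : 'M[K]_(m, n) => M i j) _ _ _ ulim).
  exact: coord_continuous.
exact: (cvg_unique (@norm_hausdorff K K^o) h (uA i j)).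
Qed.

(** This is the shape of an entry of [P *m diag_mx d *m Q] when only the diagonal varies. *)
Lemma cvg_weighted_sum (I : finType) (a b : I -> K) (u : I -> nat -> K) (x : I -> K) :
  (forall i, u i @ \oo --> x i) ->
  (fun k => \sum_i a i * u i k * b i) @ \oo --> \sum_i a i * x i * b i.
Proof.
move=> ux; elim: (index_enum I) => [|i r IH].
  by under eq_fun => k do rewrite big_nil; rewrite big_nil; exact: cvg_cst.
under eq_fun => k do rewrite big_cons; rewrite big_cons.
apply: (@cvgD K K^o _ _ _ _ _ _ _ _ IH).
have h1 : (fun k => a i * u i k) @ \oo --> a i * x i by exact: cvgMl_tmp.
by have h2 : (fun k => a i * u i k * b i) @ \oo --> a i * x i * b i by exact: cvgMr_tmp.
Qed.

End MatrixLimits.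

Lemma mul_diag_mxE (F : pzRingType) m n p (P : 'M[F]_(m, n)) (Q : 'M[F]_(n, p))
    (a : 'rV[F]_n) i j :
  (P *m diag_mx a *m Q) i j = \sum_l P i l * a 0 l * Q l j.
Proof. by rewrite mxE; apply: eq_bigr => l _; rewrite mul_mx_diag mxE. Qed.

(** Since [Q *m P] is the identity, powers of the product telescope, and the exponential series
    reduces to a scalar series on each diagonal entry. *)
Lemma expmx_similar_diag (K : numFieldType) (n : nat) (P Q : 'M[K]_n) (d e : 'rV[K]_n) :
  Q *m P = 1%:M ->
  (forall j, series (fun k => (k`!%:R)^-1 * d 0 j ^+ k) @ \oo --> e 0 j) ->
  expmx (P *m diag_mx d *m Q) = P *m diag_mx e *m Q.
Proof.
move=> QP de.
have powE k : (P *m diag_mx d *m Q) ^+ k = P *m diag_mx (\row_j d 0 j ^+ k) *m Q.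
  elim: k => [|k IH].
    rewrite expr0 -mulmxA.
    have -> : diag_mx (\row_j d 0 j ^+ 0) = 1%:M :> 'M[K]_n.
      by apply/matrixP => i j; rewrite !mxE expr0.
    by rewrite mul1mx; apply/esym/mulmx1C.
  rewrite exprS IH -[_ * _]/(_ *m _) !mulmxA -[_ *m Q *m P]mulmxA QP mulmx1.
  rewrite -[P *m _ *m diag_mx _]mulmxA mulmx_diag.
  congr (_ *m _ *m _); congr diag_mx.
  by apply/rowP => j; rewrite !mxE exprS.
rewrite /expmx; apply: lim_mx_coord => i j; rewrite mul_diag_mxE.
pose S l : nat -> K := series (fun k => (k`!%:R)^-1 * d 0 l ^+ k).
rewrite (_ : (fun k => _) = fun k => \sum_l P i l * S l k * Q l j); last first.
  apply/funext => k; rewrite /S /series /= summxE.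
  under [RHS]eq_bigr => l _ do rewrite mulr_sumr mulr_suml.
  rewrite exchange_big /=; apply: eq_bigr => k' _.
  rewrite powE mxE mul_diag_mxE mulr_sumr; apply: eq_bigr => l _.
  by rewrite !mxE !mulrA [_ * P i l]mulrC.
exact: cvg_weighted_sum.
Qed.

(** * The unit circle and the exponential of imaginary numbers *)

Section Cis.
Variable R : realType.
Implicit Types (s t : R) (x y : R[i]).
Local Notation C := (R[i] : numFieldType).

Lemma cvg_complex (u v : nat -> R) (a b : R) :
  u @ \oo --> a -> v @ \oo --> b ->
  (fun k => (u k +i* v k : C)) @ \oo --> (a +i* b : C).
Proof.
move=> ua vb; apply/cvgrPdist_lt => e e0.
(* A positive element of [R[i]] has zero imaginary part, so the radius is real and can be halved
   between the two coordinates. *)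
have [r r0 ->] : exists2 r : R, 0 < r & e = r%:C.
  by case: e e0 => r i; rewrite ltcE /= => /andP[/eqP -> r0]; exists r.
have r20 : 0 < r / 2 by rewrite divr_gt0.
near=> k.
have -> : (a +i* b) - (u k +i* v k) = (a - u k)%:C + 'i * (b - v k)%:C :> R[i].
  by simpc.
have normR (z : R) : `|z%:C| = `|z|%:C :> R[i].
  by rewrite normc_def /= expr0n addr0 sqrtr_sqr.
have normi : `|'i : R[i]| = 1 by rewrite normc_def /= expr0n add0r expr1n sqrtr1.
apply: (@le_lt_trans _ _ (`|a - u k| + `|b - v k|)%:C).
  by rewrite (le_trans (ler_normD _ _)) // normrM normi mul1r !normR rmorphD.
rewrite ltcR [r]splitr ltrD //.
- by near: k; move/cvgrPdist_lt : ua; apply.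
- by near: k; move/cvgrPdist_lt : vb; apply.
Unshelve. all: by end_near. Qed.

Definition cis t : R[i] := cos t +i* sin t.

Lemma cis0 : cis 0 = 1.
Proof. by rewrite /cis cos0 sin0. Qed.

Lemma cispi : cis pi = -1.
Proof. by rewrite /cis cospi sinpi; simpc. Qed.

Lemma cisD s t : cis (s + t) = cis s * cis t.
Proof. by rewrite /cis cosD sinD; simpc; congr (_ +i* _); rewrite addrC. Qed.

Lemma cisN t : cis (- t) = (cis t)^*.
Proof. by rewrite /cis cosN sinN. Qed.

Lemma cisNM t : cis (- t) * cis t = 1.
Proof. by rewrite -cisD addNr cis0. Qed.

Lemma cis_neq0 t : cis t != 0.
Proof.
by apply/eqP => t0; have := cisNM t; rewrite t0 mulr0 => /esym/eqP; rewrite oner_eq0.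
Qed.

(** Powers of ['i] are real for even exponents and imaginary for odd ones, so the exponential series
    splits termwise into the cosine and sine series. *)
Lemma exp_imaginaryE t (k : nat) :
  (k`!%:R)^-1 * ('i * t%:C) ^+ k = (cos_coeff t k +i* sin_coeff t k : R[i]).
Proof.
have -> : (k`!%:R)^-1 = ((k`!%:R)^-1 : R)%:C by rewrite fmorphV rmorph_nat.
rewrite exprMn -rmorphXn /= /cos_coeff /sin_coeff /=.
have -> : 'i ^+ k = ((~~ odd k)%:R * (-1) ^+ k./2 +i* ((odd k)%:R * (-1) ^+ k.-1./2)) :> R[i].
  rewrite -{1}[k]odd_double_half exprD -mul2n exprM sqr_i.
  have -> : (-1) ^+ k./2 = ((-1) ^+ k./2 : R)%:C :> R[i].
    by rewrite rmorphXn rmorphN rmorph1.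
  case: (boolP (odd k)) => ok /=; last by rewrite ?expr0 ?expr1 ?mul0r ?mul1r; simpc.
  have -> : k.-1./2 = k./2 by case: k ok => //= k ok; rewrite uphalf_half (negbTE ok).
  by rewrite ?expr0 ?expr1 ?mul0r ?mul1r; simpc.
by simpc; congr (_ +i* _); rewrite mulrC.
Qed.

Lemma cvg_exp_imaginary t :
  series (fun k => (k`!%:R)^-1 * ('i * t%:C) ^+ k : C) @ \oo --> (cis t : C).
Proof.
rewrite (_ : series _ = fun k => series (cos_coeff t) k +i* series (sin_coeff t) k).
  apply: cvg_complex.
    by have := @is_cvg_series_cos_coeff R t; rewrite unlock.
  by have := @is_cvg_series_sin_coeff R t; rewrite unlock.
apply/funext => k; rewrite /series /=.
elim: k => [|k IH]; first by rewrite !big_geq.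
by rewrite !big_nat_recr //= IH exp_imaginaryE; simpc.
Qed.

(** The arccosine of the real part fixes the angle up to sign, and the sign of the imaginary part
    decides which. *)
Lemma unit_circleP x : `|x| = 1 -> exists t, x = cis t.
Proof.
move=> x1; have : `|x| ^+ 2 = 1 by rewrite x1 expr1n.
rewrite -add_Re2_Im2; case: x {x1} => a b /= [ab1].
have b2 : b ^+ 2 = 1 - a ^+ 2 by rewrite -ab1 addrAC subrr add0r.
have aI : -1 <= a <= 1.
  by rewrite -ler_norml -(@expr_le1 _ 2) // real_normK ?num_real // -subr_ge0 -b2 sqr_ge0.
have ca : cos (acos a) = a by rewrite acosK // in_itv.
have sa : sin (acos a) = `|b| by rewrite sin_acos // -b2 sqrtr_sqr.
case: (lerP 0 b) => b0.
  by exists (acos a); rewrite /cis ca sa ger0_norm.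
by exists (- acos a); rewrite /cis cosN sinN ca sa ltr0_norm // opprK.
Qed.

Lemma cis_2piz (k : int) : cis (k%:~R * (2 * pi)) = 1.
Proof.
have cisn (m : nat) : cis (m%:R * (2 * pi)) = 1.
  elim: m => [|m IH]; first by rewrite mul0r cis0.
  rewrite -natr1 mulrDl mul1r cisD IH mul1r mulr_natl mulr2n cisD cispi.
  by rewrite mulrNN mul1r.
by case: k => m; rewrite ?NegzE ?mulrNz ?mulNr ?cisN -pmulrn cisn ?conjc1.
Qed.

Lemma cis_eqN1 t : cis t = -1 -> exists k : int, t = pi + k%:~R * (2 * pi).
Proof.
move=> t1; have pi0 := pi_gt0 R.
(* The floor brings [t] into $[0,2\pi)$. After subtracting [pi] the remainder [u] satisfies
   $|u|\le\pi$, and [cos] is injective on $[0,\pi]$, so [cis u = 1] forces [u = 0]. *)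
exists (Num.floor (t / (2 * pi))); set k := Num.floor _.
have kI : `|t - k%:~R * (2 * pi) - pi| <= pi.
  have /andP[k1 k2] := floor_itv (t / (2 * pi)).
  rewrite -/k ler_pdivlMr ?mulr_gt0 // in k1.
  rewrite -/k ltr_pdivrMr ?mulr_gt0 // intrD mulrDl mul1r in k2.
  by rewrite ler_norml; apply/andP; split; lra.
set u := t - _ - pi in kI.
have : cis u = 1.
  by rewrite /u !cisD !cisN cis_2piz cispi t1 rmorphN !rmorph1 mulr1 mulrNN mulr1.
case=> cu _; have : `|u| = 0.
  apply: cos_inj; rewrite ?in_itv /= ?normr_ge0 ?lexx ?pi_ge0 ?kI //.
  by rewrite cos_norm cu cos0.
by move/normr0_eq0; rewrite /u => u0; lra.
Qed.

Lemma expmx_similar_imaginary (n : nat) (P Q : 'M[R[i]]_n) (theta : 'I_n -> R) :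
  Q *m P = 1%:M ->
  expmx (P *m diag_mx (\row_j ('i * (theta j)%:C)) *m Q) =
  P *m diag_mx (\row_j cis (theta j)) *m Q.
Proof.
move=> QP; apply: expmx_similar_diag => // j; rewrite !mxE.
exact: cvg_exp_imaginary.
Qed.

End Cis.

(** * Tensor products described by the binary digits of row and column indices *)

Section TensorBits.

Definition split_index (n : nat) (a : 'I_(2 ^ n.+1)) : 'I_2 * 'I_(2 ^ n) :=
  mxtens_unindex (cast_ord (expnS 2 n) a).

(* [bit a l] is the row index that entry [a] of [bigtens K] selects in the
   factor [K l]; the factor of index 0 is the most significant digit. *)
Fixpoint bit (n : nat) : 'I_(2 ^ n) -> 'I_n -> 'I_2 :=
  match n with
  | 0 => fun _ _ => ord0
  | n'.+1 => fun a l =>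
      if unlift ord0 l is Some l' then bit (split_index a).2 l' else (split_index a).1
  end.

Lemma bit_ord0 n (a : 'I_(2 ^ n.+1)) : bit a ord0 = (split_index a).1.
Proof. by rewrite [LHS]/bit unlift_none. Qed.

Lemma bit_lift n (a : 'I_(2 ^ n.+1)) l : bit a (lift ord0 l) = bit (split_index a).2 l.
Proof. by rewrite {1}/bit -/bit liftK. Qed.

Lemma bit_inj n (a b : 'I_(2 ^ n)) : (forall l, bit a l = bit b l) -> a = b.
Proof.
elim: n a b => [|n IH] a b ab; first by apply: val_inj; case: a b {ab} => [[]//] ? [[]//].
apply: (@cast_ord_inj _ _ (expnS 2 n)).
apply: (can_inj (@mxtens_unindexK 2 (2 ^ n))).
rewrite -!/(split_index _); have := ab ord0; rewrite !bit_ord0.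
have : (split_index a).2 = (split_index b).2.
  by apply: IH => l; have := ab (lift ord0 l); rewrite !bit_lift.
by case: (split_index a) => ? ?; case: (split_index b) => ? ? /= -> ->.
Qed.

Lemma bit_neq n (a b : 'I_(2 ^ n)) : a != b -> exists l, bit a l != bit b l.
Proof.
move=> ab; apply/existsP; apply: contraNT ab; rewrite negb_exists => /forallP ab.
by apply/eqP/bit_inj => l; have := ab l; rewrite negbK => /eqP.
Qed.

(** Replaces the recursive definition and its casts by a product over digits, which reduces
    entrywise questions to the two-by-two factors. *)
Lemma bigtensE (C : comPzRingType) n (K : 'I_n -> 'M[C]_2) a b :
  bigtens K a b = \prod_l K l (bit a l) (bit b l).
Proof.
elim: n K a b => [|n IH] K a b.
  rewrite big_ord0 mxE; suff -> : a == b by [].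
  by apply/eqP/bit_inj; case.
rewrite big_ord_recl [LHS]/= castmxE !esymK !bit_ord0.
under eq_bigr => l _ do rewrite !bit_lift.
rewrite -[cast_ord _ a](mxtens_unindexK) -[cast_ord _ b](mxtens_unindexK).
rewrite -!/(split_index _); case: (split_index a) => x0 x1; case: (split_index b) => y0 y1.
by rewrite tensmxE IH.
Qed.

Lemma castmx_mul_sq (C : pzRingType) m n (e : m = n) (A B : 'M[C]_m) :
  castmx (e, e) (A *m B) = castmx (e, e) A *m castmx (e, e) B.
Proof. by case: n / e. Qed.

Lemma bigtensM (C : comPzRingType) n (K L : 'I_n -> 'M[C]_2) :
  bigtens (fun l => K l *m L l) = bigtens K *m bigtens L.
Proof.
elim: n K L => [|n IH] K L /=; first by rewrite mulmx1.
by rewrite -castmx_mul_sq tensmx_mul IH.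
Qed.

Lemma eq_bigtens (C : comPzRingType) n (K L : 'I_n -> 'M[C]_2) :
  K =1 L -> bigtens K = bigtens L.
Proof. by move=> /funext ->. Qed.

Lemma bigtens_diag (C : comPzRingType) n (d : 'I_n -> 'rV[C]_2) :
  bigtens (fun l => diag_mx (d l)) = diag_mx (\row_a \prod_l d l 0 (bit a l)).
Proof.
apply/matrixP => a b; rewrite bigtensE !mxE.
have [<-|ab] := eqVneq a b.
  by rewrite mulr1n; apply: eq_bigr => l _; rewrite mxE eqxx mulr1n.
have [l lab] := bit_neq ab.
by rewrite mulr0n (bigD1 l) //= mxE (negbTE lab) mulr0n mul0r.
Qed.

Lemma bigtens1 (C : comPzRingType) n : bigtens (fun _ : 'I_n => 1%:M : 'M[C]_2) = 1%:M.
Proof.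
have -> : (fun _ : 'I_n => 1%:M : 'M[C]_2) = fun=> diag_mx (const_mx 1).
  by apply/funext => _; rewrite diag_const_mx.
rewrite bigtens_diag -diag_const_mx; congr diag_mx; apply/rowP => a.
by rewrite !mxE big1 // => l _; rewrite mxE.
Qed.

Lemma bigtens_adjoint (C : numClosedFieldType) n (K : 'I_n -> 'M[C]_2) :
  (bigtens K) ^t* = bigtens (fun l => (K l) ^t*).
Proof.
apply/matrixP => a b; rewrite !mxE !bigtensE rmorph_prod.
by apply: eq_bigr => l _; rewrite !mxE.
Qed.

Definition munit_of (x y : 'I_2) : munit :=
  if x == 0 then (if y == 0 then Jalpha else Jplus)
  else (if y == 0 then Jminus else Jbeta).

Lemma munit_mx_neq0 (C : nzRingType) (J : munit) (x y : 'I_2) :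
  munit_mx C J x y != 0 -> J = munit_of x y.
Proof.
by case: J; case: x y => [[|[|//]] ?] [[|[|//]] ?]; rewrite !mxE /munit_of //= eqxx.
Qed.

Lemma munit_mx_munit_of (C : nzRingType) (x y : 'I_2) :
  munit_mx C (munit_of x y) = delta_mx x y.
Proof.
by case: x y => [[|[|//]] ?] [[|[|//]] ?]; apply/matrixP => i j; rewrite !mxE;
   congr (_ && _)%:R.
Qed.

(** The entry at [(i, j)] is 1, so no factor vanishes at its pair of digits, and a two-by-two matrix
    unit is determined by its nonzero position. Conversely, at any other position some digit differs
    and kills the product. *)
Lemma tensor_factorsP (C : comNzRingType) n (i j : 'I_(2 ^ n)) (F : 'I_n -> munit) :
  tensor_factors C i j F <-> forall l, F l = munit_of (bit i l) (bit j l).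
Proof.
split=> [ijF l|FE].
  have := congr1 (fun M : 'M[C]_(2 ^ n) => M i j) ijF.
  rewrite bigtensE mxE !eqxx /= (bigD1 l) //= => F1.
  apply: (@munit_mx_neq0 C); apply: contra_eq_neq F1 => ->.
  by rewrite mul0r oner_neq0.
apply/matrixP => a b; rewrite mxE bigtensE.
under eq_bigr => l _ do rewrite FE munit_mx_munit_of mxE.
have [<-|ai] := eqVneq a i; last first.
  by have [l li] := bit_neq ai; rewrite (bigD1 l) //= (negbTE li) mul0r.
have [<-|bj] := eqVneq b j; last first.
  by have [l lj] := bit_neq bj; rewrite (bigD1 l) //= (negbTE lj) andbF mul0r.
by rewrite big1 // => l _; rewrite !eqxx.
Qed.

End TensorBits.

(** * Unitary conjugation, its trace form and the Frobenius norm *)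

Lemma scale_mul_diag_mx (F : comPzRingType) m n p (c : F) (A : 'M[F]_(m, n))
    (d : 'rV[F]_n) (B : 'M[F]_(n, p)) :
  c *: (A *m diag_mx d *m B) = A *m diag_mx (c *: d) *m B.
Proof. by rewrite linearZ /= -scalemxAr -scalemxAl. Qed.

(** Exchanging the summation indices shows that the sum equals its own opposite. *)
Lemma sum_antisym (F : numDomainType) (I : finType) (f : I -> I -> F) :
  (forall i j, f i j = - f j i) -> \sum_i \sum_j f i j = 0.
Proof.
move=> fN; apply/eqP; rewrite -eqNr -sumrN exchange_big /=; apply/eqP.
apply: eq_bigr => i _; rewrite -sumrN; apply: eq_bigr => j _.
by rewrite [RHS]fN.
Qed.

Section UnitaryConjugation.
Variable C : numClosedFieldType.

Lemma adjoint_diag n (d : 'rV[C]_n) : (diag_mx d) ^t* = diag_mx (map_mx Num.conj d).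
Proof. by rewrite tr_diag_mx map_diag_mx. Qed.

Lemma adjointM m n p (A : 'M[C]_(m, n)) (B : 'M[C]_(n, p)) :
  (A *m B) ^t* = B ^t* *m A ^t*.
Proof. by rewrite trmx_mul map_mxM. Qed.

Lemma adjointD m n (A B : 'M[C]_(m, n)) : (A + B) ^t* = A ^t* + B ^t*.
Proof. by rewrite linearD /= map_mxD. Qed.

Lemma adjointN m n (A : 'M[C]_(m, n)) : (- A) ^t* = - A ^t*.
Proof. by rewrite linearN /= map_mxN. Qed.

Lemma adjoint_unitary n (U : 'M[C]_n) : U \is unitarymx -> U ^t* \is unitarymx.
Proof. by rewrite trmxC_unitary. Qed.

Lemma unitary_adjointK n (U : 'M[C]_n) : U \is unitarymx -> U ^t* *m U = 1%:M.
Proof. by move/adjoint_unitary/unitarymxP; rewrite trmxCK. Qed.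

Lemma AdE n (K X : 'M[C]_n) : K \is unitarymx -> Ad K X = K *m X *m K ^t*.
Proof. by move=> Ku; rewrite /Ad invmx_unitary. Qed.

Lemma AdN n (K X : 'M[C]_n) : Ad K (- X) = - Ad K X.
Proof. by rewrite /Ad mulmxN mulNmx. Qed.

Lemma Ad_unitary_conj n (V Z H : 'M[C]_n) : V \is unitarymx -> Z \is unitarymx ->
  Ad Z (V ^t* *m H *m V) = V ^t* *m Ad (V *m Z *m V ^t*) H *m V.
Proof.
move=> Vu Zu; have Vu' := adjoint_unitary Vu; have VV := unitary_adjointK Vu.
rewrite !AdE //; last exact: mul_unitarymx (mul_unitarymx Vu Zu) Vu'.
rewrite !adjointM trmxCK !mulmxA VV mul1mx.
by rewrite -[in RHS]mulmxA VV mulmx1.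
Qed.

Lemma frobenius_sqrE m n (A : 'M[C]_(m, n)) :
  frobenius A ^+ 2 = \sum_i \sum_j `|A i j| ^+ 2.
Proof. by rewrite /frobenius sqrtCK. Qed.

Lemma frobenius_sqr m n (A : 'M[C]_(m, n)) : frobenius A ^+ 2 = \tr (A ^t* *m A).
Proof.
rewrite frobenius_sqrE exchange_big /=; apply: eq_bigr => j _; rewrite mxE.
by apply: eq_bigr => i _; rewrite !mxE normCK mulrC.
Qed.

Lemma frobenius_sqr_eq0 m n (A : 'M[C]_(m, n)) : frobenius A ^+ 2 = 0 -> A = 0.
Proof.
rewrite frobenius_sqrE => A0; apply/matrixP => i j; rewrite mxE.
have ge0 k : 0 <= \sum_j `|A k j| ^+ 2 by apply: sumr_ge0 => l _; rewrite exprn_ge0.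
have := psumr_eq0P (fun k _ => ge0 k) A0 => /(_ i isT).
move/(psumr_eq0P (fun l _ => exprn_ge0 2 (normr_ge0 (A i l)))) => /(_ j isT).
by move/eqP; rewrite expf_eq0 /= normr_eq0 => /eqP.
Qed.

Lemma Ad_adjoint n (K H : 'M[C]_n) : K \is unitarymx -> H = H ^t* ->
  (Ad K H) ^t* = Ad K H.
Proof. by move=> Ku Hh; rewrite AdE // !adjointM trmxCK -Hh mulmxA. Qed.

Lemma tr_AdM n (K A B : 'M[C]_n) : K \is unitarymx ->
  \tr (Ad K A *m Ad K B) = \tr (A *m B).
Proof.
move=> Ku; have KK := unitary_adjointK Ku.
rewrite !AdE // -!mulmxA mxtrace_mulC !mulmxA -[_ *m K ^t* *m K]mulmxA KK mulmx1.
by rewrite -[_ *m K ^t* *m K]mulmxA KK mulmx1.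
Qed.

(** The square expands into two equal norms, because unitary conjugation preserves the trace form,
    and two cross terms that agree by cyclicity of the trace. *)
Lemma frobenius_AdD n (K H : 'M[C]_n) : K \is unitarymx -> H = H ^t* ->
  frobenius (Ad K H + H) ^+ 2 = 2 * (frobenius H ^+ 2 + \tr (H ^t* *m Ad K H)).
Proof.
move=> Ku Hh; rewrite !frobenius_sqr adjointD Ad_adjoint //.
rewrite mulmxDl !mulmxDr !mxtraceD tr_AdM // -!Hh [\tr (Ad K H *m H)]mxtrace_mulC.
by rewrite mulr_natl mulr2n addrACA [X in _ + X]addrC.
Qed.

(** Cyclicity of the trace moves [V] from the conjugating matrix onto [H], leaving only [Z] to
    act. *)
Lemma tr_Ad_conj n (V Z H : 'M[C]_n) : V \is unitarymx -> Z \is unitarymx -> H = H ^t* ->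
  \tr (H ^t* *m Ad (V *m Z *m V ^t*) H) =
  \tr ((V ^t* *m H *m V) ^t* *m Ad Z (V ^t* *m H *m V)).
Proof.
move=> Vu Zu Hh; have VV := unitarymxP Vu.
rewrite Ad_unitary_conj // !adjointM trmxCK -!Hh !mulmxA.
rewrite -[_ *m V *m V ^t*]mulmxA VV mulmx1 -!mulmxA [RHS]mxtrace_mulC !mulmxA.
by rewrite -[_ *m V *m V ^t*]mulmxA VV mulmx1.
Qed.

Lemma frobenius_conj n (V H : 'M[C]_n) : V \is unitarymx -> H = H ^t* ->
  frobenius (V ^t* *m H *m V) ^+ 2 = frobenius H ^+ 2.
Proof.
move=> Vu Hh; have Vu' := adjoint_unitary Vu; have := AdE H Vu'; rewrite trmxCK => <-.
by rewrite !frobenius_sqr Ad_adjoint // tr_AdM // -Hh.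
Qed.

(** Trades conjugation for an intertwining relation in the basis given by [P]; for diagonal [X] and
    [Y] that relation can be read entry by entry. *)
Lemma Ad_intertwine n (K P X Y : 'M[C]_n) : K \is unitarymx -> P \is unitarymx ->
  Ad K (P ^t* *m X *m P) = P ^t* *m Y *m P <->
  P *m K *m P ^t* *m X = Y *m (P *m K *m P ^t*).
Proof.
move=> Ku Pu; have KK := unitary_adjointK Ku; have KK' := unitarymxP Ku.
have PP := unitary_adjointK Pu; have PP' := unitarymxP Pu.
rewrite AdE //; split.
  move/(congr1 (fun M => P *m M *m (K *m P ^t*))).
  rewrite !mulmxA -[_ *m K ^t* *m K]mulmxA KK mulmx1.
  by rewrite -[_ *m P *m P ^t*]mulmxA PP' mulmx1 mul1mx.
move/(congr1 (fun M => P ^t* *m M *m (P *m K ^t*))).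
rewrite !mulmxA PP mul1mx -[_ *m P ^t* *m P]mulmxA PP mulmx1.
by rewrite -[_ *m K *m K ^t*]mulmxA KK' mulmx1.
Qed.

End UnitaryConjugation.

(** * Local unitaries and their diagonalisation inside the local group *)

Section LocalUnitaryGroup.
Variable R : realType.
Local Notation C := R[i].

(** The phase given by the local z-rotation to basis vector [a]: a digit 0 contributes
    [- phi l / 2], because [sigma_z] has eigenvalue +1 there and the exponent carries $-i$. *)
Definition zweight (n : nat) (phi : 'I_n -> R) (a : 'I_(2 ^ n)) : R :=
  \sum_l (if bit a l == 0 then -1 else 1) * (phi l / 2).

Lemma zrotE (t : R) :
  expmx ((- 'i * t%:C / 2) *: sigma_z R) =
  diag_mx (\row_j cis ((if j == 0 then -1 else 1) * (t / 2))).
Proof.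
pose theta (j : 'I_2) := (if j == 0 then -1 else 1) * (t / 2).
have := @expmx_similar_imaginary R 2 1%:M 1%:M theta (mul1mx _).
rewrite !mul1mx !mulmx1 => <-; congr expmx.
apply/matrixP => i j; rewrite !mxE /theta.
have t2 : (t / 2)%:C = t%:C / 2 :> C by rewrite rmorphM fmorphV rmorph_nat.
case: i j => [[|[|//]] ?] [[|[|//]] ?]; rewrite /= ?mulr0n ?mulr1n ?subr0 ?sub0r ?subrr ?mulr0 ?mulr1 //.
- have -> : (-1 * (t / 2))%:C = - (t%:C / 2) :> C by rewrite mulN1r -t2 rmorphN.
  by rewrite !mulNr mulrN mulrA.
- by rewrite (mul1r (t / 2)) t2 mulrN1 !mulNr opprK mulrA.
Qed.

Lemma local_zrotE n (phi : 'I_n -> R) :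
  local_zrot phi = diag_mx (\row_a cis (zweight phi a)).
Proof.
rewrite /local_zrot; under eq_bigtens => l do rewrite zrotE.
rewrite bigtens_diag; congr diag_mx; apply/rowP => a; rewrite !mxE.
under eq_bigr => l _ do rewrite mxE.
by rewrite /zweight (big_morph (@cis R) (@cisD R) (cis0 R)).
Qed.

Lemma conjC_cis (t : R) : (cis t)^*%R = cis (- t).
Proof. by rewrite cisN. Qed.

Lemma SU2_adjoint (U : 'M[C]_2) : SU2 U -> SU2 (U ^t*).
Proof.
move=> [Uu Ud]; split; first exact: adjoint_unitary.
by rewrite det_map_mx det_tr Ud rmorph1.
Qed.

Lemma SU2_mul (U V : 'M[C]_2) : SU2 U -> SU2 V -> SU2 (U *m V).
Proof.
move=> [Uu Ud] [Vu Vd]; split; first exact: mul_unitarymx.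
by rewrite det_mulmx Ud Vd mulr1.
Qed.

Lemma det_diag2 (d : 'rV[C]_2) : \det (diag_mx d) = d 0 0 * d 0 1.
Proof. by rewrite det_diag !big_ord_recl big_ord0 mulr1; congr (d _ _ * d _ _); apply: val_inj. Qed.

Lemma unitary_diag n (d : 'rV[C]_n) : (diag_mx d \is unitarymx) <-> forall j, `|d 0 j| = 1.
Proof.
split=> [/unitarymxP|d1].
  rewrite adjoint_diag mulmx_diag => /matrixP dd j.
  have := dd j j; rewrite !mxE eqxx !mulr1n -normCK => /eqP.
  by rewrite sqrf_eq1 => /orP[/eqP //|/eqP N1]; have := normr_ge0 (d 0 j); rewrite N1 ler0N1.
apply/unitarymxP; rewrite adjoint_diag mulmx_diag -diag_const_mx; congr diag_mx.
by apply/rowP => j; rewrite !mxE -normCK d1 expr1n.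
Qed.

Lemma norm_cis (t : R) : `|cis t| = 1.
Proof.
by apply/eqP; rewrite -(@eqrXn2 _ 2) // normCK conjC_cis mulrC cisNM expr1n.
Qed.

Lemma SU2_zrot (t : R) : SU2 (expmx ((- 'i * t%:C / 2) *: sigma_z R)).
Proof.
rewrite zrotE; split; first by apply/unitary_diag => j; rewrite mxE norm_cis.
by rewrite det_diag2 !mxE /= mulN1r mul1r cisNM.
Qed.

(** The spectral theorem supplies a diagonalising unitary whose determinant is only a phase.
    Rescaling one column corrects it without changing the conjugated matrix, as diagonal matrices
    commute. *)
Lemma SU2_diag (U : 'M[C]_2) : SU2 U ->
  exists V t, SU2 V /\ U = V *m expmx ((- 'i * t%:C / 2) *: sigma_z R) *m V ^t*.
Proof.
move=> [Uu Ud].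
have /orthomx_spectralP : U \is normalmx.
  apply/normalmxP; rewrite (unitarymxP Uu).
  by have := Uu; rewrite -trmxC_unitary => /unitarymxP; rewrite trmxCK.
set P := spectralmx U; set d := spectral_diag U => UE.
have Pu : P \is unitarymx := spectral_unitarymx U.
rewrite invmx_unitary // in UE.
have Pu' : P ^t* \is unitarymx by rewrite trmxC_unitary.
have dE : diag_mx d = P *m U *m P ^t*.
  by rewrite UE !mulmxA (unitarymxP Pu) mul1mx mulmxtVK.
have du : diag_mx d \is unitarymx.
  by rewrite dE; exact: mul_unitarymx (mul_unitarymx Pu Uu) Pu'.
have dn := (unitary_diag d).1 du.
have dd : d 0 0 * d 0 1 = 1.
  rewrite -det_diag2 dE !det_mulmx Ud mulr1 -det_mulmx (unitarymxP Pu); exact: det1.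
have [t d0] := unit_circleP (dn 0).
(* Determinant one makes the eigenvalues mutually inverse, so a single angle describes both. *)
have d1 : d 0 1 = cis (- t).
  by apply: (mulfI (cis_neq0 t)); rewrite -{1}d0 dd mulrC cisNM.
have detP : \det P * (\det P)^* = 1.
  by have := congr1 determinant (unitarymxP Pu); rewrite det_mulmx det_map_mx det_tr det1.
(* The determinant of [P ^t*] is the conjugate of the phase [\det P], so this factor brings the
   product to determinant one. *)
pose D : 'rV[C]_2 := \row_j (if j == 0 then \det P else 1).
have DD : diag_mx D \is unitarymx.
  apply/unitary_diag => j; rewrite mxE; case: eqP => _; rewrite ?normr1 //.
  by apply/eqP; rewrite -(@eqrXn2 _ 2) // normCK detP expr1n.
(* The z-rotation by [phi] has upper entry [cis (- phi / 2)], which has to equal [cis t]. *)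
exists (P ^t* *m diag_mx D), (- (2 * t)); split.
  split; first exact: mul_unitarymx Pu' DD.
  by rewrite det_mulmx det_diag2 !mxE /= mulr1 det_map_mx det_tr mulrC.
rewrite zrotE adjointM trmxCK UE -!mulmxA; congr (_ *m _); rewrite !mulmxA; congr (_ *m _).
rewrite adjoint_diag !mulmx_diag; congr diag_mx; apply/rowP => j; rewrite !mxE.
rewrite mulrAC; have -> : - (2 * t) / 2 = - t by field.
case: j => [[|[|//]] ?] /=; rewrite ?mulN1r ?mul1r ?opprK ?detP ?rmorph1 ?mulr1 ?mul1r.
  by rewrite -d0; congr (d _ _); apply: val_inj.
by rewrite -d1; congr (d _ _); apply: val_inj.
Qed.

Lemma unitary_localSU2 n (K : 'M[C]_(2 ^ n)) : localSU2 K -> K \is unitarymx.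
Proof.
case=> U US ->; apply/unitarymxP; rewrite bigtens_adjoint -bigtensM -bigtens1.
by apply: eq_bigtens => l; have [/unitarymxP] := US l.
Qed.

Lemma localSU2_adjoint n (K : 'M[C]_(2 ^ n)) : localSU2 K -> localSU2 (K ^t*).
Proof.
case=> U US ->; exists (fun l => (U l) ^t*); last exact: bigtens_adjoint.
by move=> l; exact: SU2_adjoint.
Qed.

Lemma localSU2_mul n (K L : 'M[C]_(2 ^ n)) :
  localSU2 K -> localSU2 L -> localSU2 (K *m L).
Proof.
case=> U US -> [V VS ->]; exists (fun l => U l *m V l); last by rewrite bigtensM.
by move=> l; exact: SU2_mul.
Qed.

Lemma localSU2_zrot n (phi : 'I_n -> R) : localSU2 (local_zrot phi).
Proof. by eexists; last reflexivity; move=> l; exact: SU2_zrot. Qed.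

(** Each factor is diagonalised separately; the tensor product respects products and adjoints, so
    the pieces reassemble. *)
Lemma localSU2_diag n (K : 'M[C]_(2 ^ n)) : localSU2 K ->
  exists2 V, localSU2 V & exists phi, K = V *m local_zrot phi *m V ^t*.
Proof.
case=> U US ->.
have [V UV] := choice (fun l => SU2_diag (US l)).
have [phi Uphi] := choice UV.
exists (bigtens V); first by exists V => // l; have [] := Uphi l.
exists phi; rewrite bigtens_adjoint /local_zrot -!bigtensM.
by apply: eq_bigtens => l; have [] := Uphi l.
Qed.

End LocalUnitaryGroup.

(** * Local z-rotations acting on matrix entries *)

Section SignReversal.
Variable R : realType.
Local Notation C := R[i].

(** Matrix units are eigenvectors of conjugation by a diagonal unitary, and the eigenvalue is
    governed by the difference of weights, that is, by the root. *)
Lemma Ad_zrotE n (phi : 'I_n -> R) (X : 'M[C]_(2 ^ n)) a b :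
  Ad (local_zrot phi) X a b = cis (zweight phi a - zweight phi b) * X a b.
Proof.
rewrite (AdE _ (unitary_localSU2 (localSU2_zrot phi))).
rewrite local_zrotE adjoint_diag mul_mx_diag mxE mul_diag_mx mxE !mxE.
by rewrite conjC_cis cisD mulrAC.
Qed.

Lemma Ad_zrotN n (phi : 'I_n -> R) (X : 'M[C]_(2 ^ n)) :
  Ad (local_zrot phi) X = - X <->
  forall a b, X a b != 0 -> cis (zweight phi a - zweight phi b) = -1.
Proof.
split=> [XN a b ab|XN].
  have /matrixP/(_ a b) := XN; rewrite Ad_zrotE mxE => h.
  by apply: (mulIf ab); rewrite h mulN1r.
apply/matrixP => a b; rewrite Ad_zrotE mxE.
by have [->|/XN ->] := eqVneq (X a b) 0; rewrite ?mulr0 ?oppr0 ?mulN1r.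
Qed.

(** This is the squared modulus of an entry, kept in [R] so that order and continuity arguments take
    place over the reals. *)
Definition entry_weight m n (X : 'M[C]_(m, n)) i j : R :=
  complex.Re (X i j) ^+ 2 + complex.Im (X i j) ^+ 2.

Lemma entry_weight_ge0 m n (X : 'M[C]_(m, n)) i j : 0 <= entry_weight X i j.
Proof. by rewrite addr_ge0 ?sqr_ge0. Qed.

Lemma sum_entry_weight m n (X : 'M[C]_(m, n)) :
  (\sum_i \sum_j entry_weight X i j)%:C = frobenius X ^+ 2.
Proof.
rewrite frobenius_sqrE rmorph_sum; apply: eq_bigr => i _.
by rewrite rmorph_sum; apply: eq_bigr => j _; rewrite -add_Re2_Im2.
Qed.

Lemma sum_complex (I : finType) (x y : I -> R) :
  \sum_i (x i +i* y i) = (\sum_i x i) +i* (\sum_i y i) :> C.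
Proof. by apply/esym; elim/big_rec3 : _ => // i a b c _ <-; simpc. Qed.

(* The imaginary part cancels because the weights are symmetric for Hermitian X. *)
Lemma tr_Ad_zrot n (phi : 'I_n -> R) (X : 'M[C]_(2 ^ n)) : X = X ^t* ->
  \tr (X ^t* *m Ad (local_zrot phi) X) =
  (\sum_a \sum_b entry_weight X a b * cos (zweight phi a - zweight phi b))%:C.
Proof.
move=> Xh; set w := zweight phi; set q := entry_weight X.
have qC a b : q a b = q b a.
  by rewrite /q /entry_weight {1 2}Xh !mxE; case: (X b a) => x y /=; rewrite sqrrN.
have -> : \tr (X ^t* *m Ad (local_zrot phi) X) =
    \sum_a \sum_b ((q a b * cos (w a - w b)) +i* (q a b * sin (w a - w b))).
  rewrite /mxtrace exchange_big /=; apply: eq_bigr => b _; rewrite mxE.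
  apply: eq_bigr => a _; rewrite Ad_zrotE !mxE mulrCA -/w.
  have -> : (X a b)^*%R * X a b = (q a b)%:C by rewrite mulrC -normCK -add_Re2_Im2.
  by rewrite /cis; simpc; rewrite mulrC [_ * sin _]mulrC.
under eq_bigr => a _ do rewrite sum_complex.
rewrite sum_complex; congr (_ +i* _).
by apply: sum_antisym => a b; rewrite qC -opprB sinN mulrN.
Qed.

(** * Exponentials of Hermitian matrices and sign reversal for all times *)

Lemma hermitian_diag n (H : 'M[C]_n) : H = H ^t* ->
  exists2 P : 'M[C]_n, P \is unitarymx &
    exists theta : 'I_n -> R, H = P ^t* *m diag_mx (\row_j (theta j)%:C) *m P.
Proof.
move=> Hh; have Hs : H \is hermsymmx.
  by apply/is_hermitianmxP; rewrite expr0 scale1r.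
exists (spectralmx H); first exact: spectral_unitarymx.
exists (fun j => complex.Re (spectral_diag H 0 j)).
have /hermitian_normalmx/orthomx_spectralP := Hs.
rewrite (invmx_unitary (spectral_unitarymx H)) => HE.
have dE : spectral_diag H = \row_j (complex.Re (spectral_diag H 0 j))%:C.
  apply/rowP => j; rewrite mxE (RRe_real (mxOverP (hermitian_spectral_diag_real Hs) 0 j)).
  reflexivity.
by rewrite -dE.
Qed.

Lemma expmx_hermitian n (P : 'M[C]_n) (theta : 'I_n -> R) (t : R) : P \is unitarymx ->
  expmx (('i * t%:C) *: (P ^t* *m diag_mx (\row_j (theta j)%:C) *m P)) =
  P ^t* *m diag_mx (\row_j cis (t * theta j)) *m P.
Proof.
move=> Pu; rewrite -expmx_similar_imaginary; last exact: unitarymxP.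
rewrite scale_mul_diag_mx.
have -> : ('i * t%:C) *: (\row_j (theta j)%:C) = \row_j ('i * (t * theta j)%:C).
  by apply/rowP => j; rewrite !mxE rmorphM mulrA.
by [].
Qed.

(** The conjugate of [H] is diagonalised by [P *m K ^t*] with the same eigenvalues, so one diagonal
    formula computes both exponentials. *)
Lemma Ad_expmx n (K H : 'M[C]_n) (t : R) : K \is unitarymx -> H = H ^t* ->
  Ad K (expmx (('i * t%:C) *: H)) = expmx (('i * t%:C) *: Ad K H).
Proof.
move=> Ku /hermitian_diag[P Pu [theta ->]].
have Qu : P *m K ^t* \is unitarymx := mul_unitarymx Pu (adjoint_unitary Ku).
have E X : Ad K (P ^t* *m X *m P) = (P *m K ^t*) ^t* *m X *m (P *m K ^t*).
  by rewrite (AdE _ Ku) adjointM trmxCK !mulmxA.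
rewrite (expmx_hermitian _ _ Pu) 2!E (expmx_hermitian _ _ Qu).
reflexivity.
Qed.

Lemma scaleNiE n (t : R) (H : 'M[C]_n) : (- 'i * t%:C) *: H = ('i * t%:C) *: - H.
Proof. by rewrite mulNr scaleNr scalerN. Qed.

Lemma AdN_sign_reversible n (K H : 'M[C]_(2 ^ n)) : localSU2 K -> H = H ^t* ->
  Ad K H = - H -> sign_reversible_typeI H.
Proof.
move=> Kl Hh KH; have Ku := unitary_localSU2 Kl; exists K => // t.
have NHh : - H = (- H) ^t* by rewrite adjointN -Hh.
by rewrite scaleNiE (Ad_expmx _ Ku NHh) AdN KH opprK.
Qed.

Lemma N1_neq1 : (-1 : C) <> 1.
Proof. by move/(congr1 (@complex.Re R)) => /= h; lra. Qed.

(* In an eigenbasis of H, an entry of K between eigenvectors of eigenvalues x and y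
   survives only if exp(it(x + y)) = 1 for all t, that is, if x = -y. *)
Lemma sign_reversible_AdN n (H : 'M[C]_(2 ^ n)) : H = H ^t* ->
  sign_reversible_typeI H -> exists2 K, localSU2 K & Ad K H = - H.
Proof.
move=> Hh [K Kl KH]; have Ku := unitary_localSU2 Kl; exists K => //.
have [P Pu [theta HE]] := hermitian_diag Hh.
pose L := P *m K *m P ^t*.
have LE t : L *m diag_mx (\row_j cis (- t * theta j)) = diag_mx (\row_j cis (t * theta j)) *m L.
  apply: (Ad_intertwine _ _ Ku Pu).1; rewrite -!(expmx_hermitian _ _ Pu) -HE.
  have -> : 'i * (- t)%:C = - 'i * t%:C :> C by rewrite rmorphN mulrN mulNr.
  exact: KH.
have LD : L *m diag_mx (\row_j (theta j)%:C) = (- diag_mx (\row_j (theta j)%:C)) *m L.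
  clearbody L; rewrite mulNmx.
  apply/matrixP => a b; rewrite mul_mx_diag mul_diag_mx !mxE.
  have [->|L0] := eqVneq (L a b) 0; first by rewrite mulr0 mul0r oppr0.
  suff -> : theta a = - theta b by rewrite rmorphN mulNr opprK mulrC.
  apply/eqP; rewrite -addr_eq0; apply/negPn/negP => ab0.
  (* At this time the phase identity for the surviving entry would say that [cis pi] equals 1. *)
  set t := pi / (theta a + theta b).
  have /matrixP/(_ a b) := LE t.
  rewrite mul_mx_diag mul_diag_mx !mxE mulrC => /(mulIf L0) e.
  have : cis (t * (theta a + theta b)) = 1.
    by rewrite mulrDr cisD -e -cisD mulNr addNr cis0.
  by rewrite divfK // cispi => /N1_neq1.
rewrite HE -mulNmx -mulmxN; exact: (Ad_intertwine _ _ Ku Pu).2 LD.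
Qed.

(** * Trace values over the local group and the segment they fill *)

Lemma AdN_conj n (V Z H : 'M[C]_n) : V \is unitarymx -> Z \is unitarymx ->
  Ad (V *m Z *m V ^t*) H = - H <-> Ad Z (V ^t* *m H *m V) = - (V ^t* *m H *m V).
Proof.
move=> Vu Zu; rewrite (Ad_unitary_conj _ Vu Zu); split=> [->|].
  by rewrite mulmxN mulNmx.
move/(congr1 (fun M => V *m M *m V ^t*)); rewrite mulmxN mulNmx !mulmxA (unitarymxP Vu) !mul1mx.
by rewrite -[LHS]mulmxA -[X in _ = - X -> _]mulmxA (unitarymxP Vu) !mulmx1.
Qed.

Lemma tr_Ad_local n (V H : 'M[C]_(2 ^ n)) (phi : 'I_n -> R) : localSU2 V -> H = H ^t* ->
  \tr (H ^t* *m Ad (V *m local_zrot phi *m V ^t*) H) =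
  (\sum_a \sum_b entry_weight (V ^t* *m H *m V) a b *
     cos (zweight phi a - zweight phi b))%:C.
Proof.
move=> /unitary_localSU2 Vu Hh.
rewrite (tr_Ad_conj Vu (unitary_localSU2 (localSU2_zrot phi)) Hh) tr_Ad_zrot //.
by rewrite !adjointM trmxCK -Hh mulmxA.
Qed.

Lemma sum_entry_weight_conj n (V H : 'M[C]_n) : V \is unitarymx -> H = H ^t* ->
  frobenius H = 1 -> \sum_a \sum_b entry_weight (V ^t* *m H *m V) a b = 1.
Proof.
move=> Vu Hh H1; apply: (@complexI R).
by rewrite sum_entry_weight (frobenius_conj Vu Hh) H1 expr1n.
Qed.

Lemma zweightZ n (phi : 'I_n -> R) s a : zweight (fun l => s * phi l) a = s * zweight phi a.
Proof. by rewrite /zweight mulr_sumr; apply: eq_bigr => l _; rewrite -mulrA mulrCA. Qed.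

(** Digit by digit: [Jplus] sits in row 0 and column 1, where the weights are [- phi l / 2] and
    [phi l / 2], so their difference is the opposite of the root's contribution; [Jminus] is
    symmetric. *)
Lemma zweightB n (phi : 'I_n -> R) a b :
  \sum_(l < n) (munit_p (munit_of (bit a l) (bit b l)))%:~R * phi l =
  - (zweight phi a - zweight phi b).
Proof.
rewrite /zweight -sumrB -sumrN; apply: eq_bigr => l _.
rewrite /munit_of; case: (bit a l == 0); case: (bit b l == 0) => /=.
- by rewrite mul0r subrr oppr0.
- by rewrite rmorph1; field.
- by rewrite rmorphN1; field.
- by rewrite mul0r subrr oppr0.
Qed.

Lemma continuous_sum_fin (I : finType) (f : I -> R -> R) :
  (forall i, continuous (f i)) -> continuous (fun s => \sum_i f i s).
Proof.
move=> fc x; rewrite /continuous_at; elim: (index_enum I) => [|i r IH].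
  by under eq_fun => k do rewrite big_nil; rewrite big_nil; exact: cvg_cst.
under eq_fun => k do rewrite big_cons; rewrite big_cons.
exact: (cvgD (fc i x) IH).
Qed.

Lemma locally_similarP n (H X : 'M[C]_(2 ^ n)) :
  locally_similar H X <-> exists2 V, localSU2 V & X = V ^t* *m H *m V.
Proof.
split=> -[V Vl]; have Vu := unitary_localSU2 Vl.
  by rewrite (invmx_unitary Vu) => XE; exists V.
by rewrite -(invmx_unitary Vu) => XE; exists V.
Qed.

Lemma tr_Ad_localN n (K H : 'M[C]_(2 ^ n)) :
  \tr ((- H) ^t* *m Ad K H) = - \tr (H ^t* *m Ad K H).
Proof. by rewrite adjointN mulNmx linearN. Qed.

Lemma Wloc_segment n (H : 'M[C]_(2 ^ n)) : H = H ^t* -> frobenius H = 1 ->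
  Wloc H H (- 1) -> Wloc (- H) H = [set x%:C | x in `[(- 1 : R), 1]].
Proof.
move=> Hh H1 [K Kl KH]; apply/seteqP; split=> z.
  case=> K' /localSU2_diag[V Vl [phi ->]] <-.
  rewrite tr_Ad_localN (tr_Ad_local _ Vl Hh).
  set q := entry_weight _.
  have q1 : \sum_a \sum_b q a b = 1.
    exact: sum_entry_weight_conj (unitary_localSU2 Vl) Hh H1.
  exists (- \sum_a \sum_b q a b * cos (zweight phi a - zweight phi b)); last by rewrite rmorphN.
  (* Writing the bound 1 as the total weight lets the triangle inequality work term by term, since
     no cosine exceeds 1 in absolute value. *)
  rewrite /= in_itv /= -ler_norml normrN -q1.
  apply: (le_trans (ler_norm_sum _ _ _)); apply: ler_sum => a _.
  apply: (le_trans (ler_norm_sum _ _ _)); apply: ler_sum => b _.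
  by rewrite normrM ger0_norm ?entry_weight_ge0 // ler_piMr ?entry_weight_ge0 ?cos_max.
case=> x /= xI <-.
have [V Vl [phi KE]] := localSU2_diag Kl.
set q := entry_weight (V ^t* *m H *m V).
have q1 : \sum_a \sum_b q a b = 1.
  exact: sum_entry_weight_conj (unitary_localSU2 Vl) Hh H1.
(* Scaling all angles by [s] gives a path inside the local group, starting at the identity; [f] is
   the trace along it. *)
pose f s := - \sum_a \sum_b q a b * cos (s * (zweight phi a - zweight phi b)).
have trE s : \tr ((- H) ^t* *m Ad (V *m local_zrot (fun l => s * phi l) *m V ^t*) H) = (f s)%:C.
  rewrite tr_Ad_localN (tr_Ad_local _ Vl Hh) /f rmorphN; congr (- _%:C).
  by apply: eq_bigr => a _; apply: eq_bigr => b _; rewrite !zweightZ mulrBr.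
have f0 : f 0 = -1.
  rewrite /f -q1; congr (- _); apply: eq_bigr => a _; apply: eq_bigr => b _.
  by rewrite mul0r cos0 mulr1.
(* At [s = 1] the path reaches [K], whose trace against [H] is -1 by hypothesis, hence +1 against
   [- H]. *)
have f1 : f 1 = 1.
  apply: (@complexI R); rewrite -trE.
  have -> : (fun l => 1 * phi l) = phi by apply/funext => l; rewrite mul1r.
  by rewrite -KE tr_Ad_localN KH opprK.
have fc : continuous f.
  move=> s; apply: cvgN; move: s.
  apply: continuous_sum_fin => a; apply: continuous_sum_fin => b s.
  apply: cvgM; first exact: cvg_cst.
  apply: continuous_cvg; first exact: continuous_cos.
  by apply: cvgM; [exact: cvg_id|exact: cvg_cst].
have [] := @IVT R f 0 1 x ler01.
- exact: continuous_subspaceT.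
- have N11 : (-1 : R) <= 1 by lra.
  by rewrite f0 f1 min_l // max_r //; move: xI; rewrite in_itv.
move=> s _ fs; exists (V *m local_zrot (fun l => s * phi l) *m V ^t*); last by rewrite trE fs.
exact: localSU2_mul (localSU2_mul Vl (localSU2_zrot _)) (localSU2_adjoint Vl).
Qed.

End SignReversal.

(** * Equivalence of the conditions through a cycle of implications *)

Theorem corollary3 (R : realType) (n : nat) (n_ge1 : (1 <= n)%N)
    (H : 'M[R[i]]_(2 ^ n)) (H_herm : H = H ^t*) (H_tr0 : \tr H = 0)
    (H_norm1 : frobenius H = 1) :
  [<->
    (* (1) *)
    sign_reversible_typeI H;
    (* (2) *)
    Wloc H H (- 1);
    (* (3) *)
    Wloc (- H) H = [set x%:C | x in `[(- 1 : R), 1]];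
    (* (4) *)
    exists2 K, localSU2 K & frobenius (Ad K H + H) ^+ 2 = 0;
    (* (4), second form *)
    exists2 K, localSU2 K & Ad K H = - H;
    (* (5) *)
    exists2 Hbar : 'M[R[i]]_(2 ^ n), locally_similar H Hbar &
      exists phi : 'I_n -> R, Ad (local_zrot phi) Hbar = - Hbar;
    (* (6) *)
    exists2 Hbar : 'M[R[i]]_(2 ^ n), locally_similar H Hbar &
      exists (m : nat) (c : 'I_m -> R[i]) (i j : 'I_m -> 'I_(2 ^ n))
             (F : 'I_m -> 'I_n -> munit),
      [/\ forall a : 'I_m, i a != j a,
          Hbar = \sum_(a < m) c a *: delta_mx (i a) (j a),
          forall a : 'I_m, tensor_factors R[i] (i a) (j a) (F a) &
          exists phi : 'I_n -> R, forall a : 'I_m,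
            let s := \sum_(l < n) (munit_p (F a l))%:~R * phi l in
            eqmod2pi s pi \/ eqmod2pi s (- pi)]
  ].
Proof.
tfae.
- move=> /(sign_reversible_AdN H_herm)[K Kl KH]; exists K => //.
  rewrite KH mulmxN linearN /= -frobenius_sqr H_norm1.
  by rewrite expr1n.
- exact: Wloc_segment.
(* The endpoint +1 is attained at some [K] whose trace against [H] is -1, which makes the expanded
   norm vanish. *)
- move=> WE; have : Wloc (- H) H 1%:C.
    by rewrite WE; exists 1 => //=; rewrite in_itv /=; lra.
  case=> K Kl; rewrite tr_Ad_localN => KH; exists K => //.
  rewrite (frobenius_AdD (unitary_localSU2 Kl) H_herm) H_norm1 expr1n.
  by rewrite -[\tr _]opprK KH subrr mulr0.
- move=> [K Kl /frobenius_sqr_eq0/eqP]; rewrite addr_eq0 => /eqP KH.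
  by exists K.
- move=> [K Kl KH]; have [V Vl [phi KE]] := localSU2_diag Kl.
  have Vu := unitary_localSU2 Vl.
  have Zu := unitary_localSU2 (localSU2_zrot phi).
  exists (V ^t* *m H *m V); first by apply/locally_similarP; exists V.
  by exists phi; apply: (AdN_conj _ Vu Zu).1; rewrite -KE.
- move=> [X HX [phi /Ad_zrotN phiX]]; exists X => //.
  (* The support of [X] lists the root-space elements, one term per nonzero entry. *)
  pose A := [pred p : 'I_(2 ^ n) * 'I_(2 ^ n) | X p.1 p.2 != 0].
  pose p (a : 'I_#|A|) := enum_val a.
  have pA a : X (p a).1 (p a).2 != 0 by have := enum_valP a.
  exists #|A|, (fun a => X (p a).1 (p a).2), (fun a => (p a).1), (fun a => (p a).2).
  exists (fun a l => munit_of (bit (p a).1 l) (bit (p a).2 l)); split.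
  (* A diagonal position would carry the phase [cis 0], which is 1 instead of -1. *)
  + move=> a; apply/eqP => a12; have := phiX _ _ (pA a).
    by rewrite a12 subrr cis0 => /esym/N1_neq1.
  + rewrite {1}[X]matrix_sum_delta pair_big /=.
    have := big_enum_val (fun q => X q.1 q.2 *: delta_mx q.1 q.2) (A := A) (op := +%R) (idx := 0) => <-.
    rewrite [RHS]big_mkcond /=; apply: eq_bigr => q _.
    by rewrite inE; case: eqP => //= ->; rewrite scale0r.
  + by move=> a; apply/tensor_factorsP.
  (* The system sees minus the weight difference, hence the sign [- pi] and the negated multiple of
     $2\pi$. *)
  + exists phi => a; right; rewrite /= zweightB.
    have [k ->] := cis_eqN1 (phiX _ _ (pA a)).
    by exists (- k); rewrite opprD mulrNz mulNr.
- move=> [X /locally_similarP[V Vl XE] [m [c [i [j [F [_ XF FE [phi phiF]]]]]]]].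
  have Vu := unitary_localSU2 Vl; have Zl := localSU2_zrot phi.
  have XZ : Ad (local_zrot phi) X = - X.
    apply/Ad_zrotN => a b ab.
    (* At a position outside the list every term of the sum is zero, so each nonzero entry of [X]
       sits at a listed root. *)
    have [r /andP[/eqP-> /eqP->]] : exists r, (a == i r) && (b == j r).
      apply/existsP; apply: contraNT ab; rewrite negb_exists => /forallP ab.
      rewrite XF summxE big1 // => r _; rewrite !mxE (negbTE (ab r)).
      by rewrite mulr0.
    have := phiF r; have FrE := (tensor_factorsP _ _ _ _).1 (FE r).
    rewrite /=; under eq_bigr => l _ do rewrite FrE.
    (* The phase is the conjugate of [cis] of the sum, and [cis] equals -1 at both [pi] and
       [- pi]. *)
    rewrite zweightB -[in X in _ -> X](opprK (_ - _)) cisN.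
    by case=> -[k ->]; rewrite cisD cis_2piz mulr1 ?cisN cispi !rmorphN !rmorph1.
  rewrite XE in XZ.
  (* Conjugating the z-rotation back by [V] gives a local unitary that reverses [H] itself. *)
  apply: (AdN_sign_reversible _ H_herm ((AdN_conj _ Vu (unitary_localSU2 Zl)).2 XZ)).
  exact: localSU2_mul (localSU2_mul Vl Zl) (localSU2_adjoint Vl).
Qed.
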